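(* Let $f$ be a non-square positive integer and let $(c,h)$ be the smallest pair of positive integers with $c^2-fh^2=1$. Suppose $\sqrt{f}=[\,a_0;\overline{a_1,\dots,a_{m-1},a_m,a_{m-1},\dots,a_1,2a_0}\,]$ (period length $2m$), where $a_m=a_0$ or $a_m=a_0-1$, and $m$ is even. Let $f(t)=(c+1)^2h^2t^2+2(c+1)^2t+f$. Then for every integer $t\ge 0$, $$\sqrt{f(t)}=[\,(c+1)ht+a_0;\overline{a_1,\dots,a_{m-1},(c+1)ht+a_m,a_{m-1},\dots,a_1,2(c+1)ht+2a_0}\,],$$ and $X=(c+1)h^4t^2+2(c+1)h^2t+c$, $Y=h^3t+h$ is the fundamental solution (smallest solution in positive integers) of $X^2-f(t)Y^2=1$.
   Context: $[\,b_0;\overline{b_1,\dots,b_k}\,]$ denotes the simple periodic continued fraction with the overlined block repeating. The fundamental solution of $X^2-DY^2=1$ is its smallest solution in positive integers. *)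

(* Defs.v *)
From Stdlib Require Import Reals ZArith List.
From Coquelicot Require Import Coquelicot.
Import ListNotations.
Open Scope Z_scope.

(** [cf_convergent b n] is the finite continued fraction
    [b 0; b 1, ..., b n]. *)
Fixpoint cf_convergent (b : nat -> Z) (n : nat) : R :=
  match n with
  | O => IZR (b 0%nat)
  | S n' => (IZR (b 0%nat) + / cf_convergent (fun i => b (S i)) n')%R
  end.

(** The condition on the partial quotients is the one defining a _simple_
    continued fraction; it also keeps every denominator in the convergents
    nonzero. *)
Definition is_simple_cf (x : R) (b : nat -> Z) : Prop :=
  (forall i : nat, (1 <= i)%nat -> 0 < b i) /\
  is_lim_seq (cf_convergent b) (Finite x).

Definition periodic_seq (b0 : Z) (block : list Z) (i : nat) : Z :=
  match i with
  | O => b0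
  | S j => nth (j mod length block)%nat block 0
  end.

(** The repeating block need not be the shortest possible one; see
    [is_least_period]. *)
Definition is_periodic_cf (x : R) (b0 : Z) (block : list Z) : Prop :=
  block <> nil /\ is_simple_cf x (periodic_seq b0 block).

(** Periods of the sequence of partial quotients, disregarding [b 0]. *)
Definition is_period (b : nat -> Z) (p : nat) : Prop :=
  (0 < p)%nat /\ forall i : nat, (1 <= i)%nat -> b (i + p)%nat = b i.

Definition is_least_period (b : nat -> Z) (p : nat) : Prop :=
  is_period b p /\ forall q : nat, is_period b q -> (p <= q)%nat.

(** The block a_1, ..., a_{m-1}, mid, a_{m-1}, ..., a_1, last
    (of length 2m, for m >= 1). *)
Definition sym_block (a : nat -> Z) (m : nat) (mid last : Z) : list Z :=
  let l := map a (seq 1 (m - 1)) in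
  l ++ [mid] ++ rev l ++ [last].

Definition is_pell_solution (D X Y : Z) : Prop :=
  0 < X /\ 0 < Y /\ X ^ 2 - D * Y ^ 2 = 1.

(** "Smallest" is taken in both coordinates at once; for D > 0 this agrees with
    minimality of X alone or of Y alone, as each coordinate of a positive
    solution is an increasing function of the other. *)
Definition is_fundamental_solution (D X Y : Z) : Prop :=
  is_pell_solution D X Y /\
  forall X' Y' : Z, is_pell_solution D X' Y' -> X <= X' /\ Y <= Y'.

(* Main.v *)
Require Import Defs.
From Stdlib Require Import Reals ZArith List Lia Lra.
From Coquelicot Require Import Coquelicot.
Import ListNotations.
Open Scope Z_scope.

(** Let [A B; C D] be the product of the matrices [a_i 1; 1 0] for 0 < i < m, let
    p = a_0 A + C and v = a_m A + 2 B.  The symmetric expansion of sqrt f is equivalent to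
    v (p^2 - f A^2) = 2 p, and the condition on a_m forces p^2 - f A^2 = 2, that is v = p.
    Since the fundamental solution read off a shortest period of even length is
    (p v - 1, A v), this gives c + 1 = p^2 and h = p A.  With s = (c + 1) h t, replacing
    a_0, a_m, f by a_0 + s, a_m + s, f(t) turns p and v into p + A s and preserves the norm
    equation, so f(t) has the announced expansion; for t > 0 its last partial quotient
    strictly exceeds the others, so its period is again the shortest. *)

#[local] Arguments Z.mul : simpl never.
#[local] Arguments Z.add : simpl never.

(** * Continued fraction matrices and the size of their entries *)

Record mat2 := Mat2 { e11 : Z; e12 : Z; e21 : Z; e22 : Z }.

Definition mat2_mul (M N : mat2) : mat2 :=
  Mat2 (e11 M * e11 N + e12 M * e21 N) (e11 M * e12 N + e12 M * e22 N)
       (e21 M * e11 N + e22 M * e21 N) (e21 M * e12 N + e22 M * e22 N).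

Definition mat2_tr (M : mat2) : mat2 := Mat2 (e11 M) (e21 M) (e12 M) (e22 M).

Definition mat2_det (M : mat2) : Z := e11 M * e22 M - e12 M * e21 M.

Definition cf_step (a : Z) : mat2 := Mat2 a 1 1 0.

Definition cf_mat (l : list Z) : mat2 :=
  fold_right (fun a M => mat2_mul (cf_step a) M) (Mat2 1 0 0 1) l.

Lemma mat2_ext (M N : mat2) :
  e11 M = e11 N -> e12 M = e12 N -> e21 M = e21 N -> e22 M = e22 N -> M = N.
Proof. destruct M, N; simpl; congruence. Qed.

Lemma mat2_mul_assoc (M N P : mat2) :
  mat2_mul M (mat2_mul N P) = mat2_mul (mat2_mul M N) P.
Proof. apply mat2_ext; simpl; ring. Qed.

Lemma cf_mat_app (l l' : list Z) :
  cf_mat (l ++ l') = mat2_mul (cf_mat l) (cf_mat l').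
Proof.
  induction l as [|a l IH]; simpl.
  - apply mat2_ext; simpl; ring.
  - rewrite IH. apply mat2_mul_assoc.
Qed.

(** Each [cf_step a] is symmetric, so transposing a product reverses its factors. *)
Lemma cf_mat_rev (l : list Z) : cf_mat (rev l) = mat2_tr (cf_mat l).
Proof.
  induction l as [|a l IH]; [reflexivity|].
  simpl. rewrite cf_mat_app, IH. apply mat2_ext; simpl; ring.
Qed.

Lemma cf_mat_palindrome (w : list Z) :
  rev w = w -> e21 (cf_mat w) = e12 (cf_mat w).
Proof. intros H. rewrite <- H at 1. now rewrite cf_mat_rev. Qed.

Lemma cf_mat_det (l : list Z) :
  mat2_det (cf_mat l) = if Nat.even (length l) then 1 else -1.
Proof.
  induction l as [|a l IH]; [reflexivity|].
  change (length (a :: l)) with (S (length l)).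
  rewrite Nat.even_succ, <- Nat.negb_even.
  unfold mat2_det in *; simpl.
  destruct (Nat.even (length l)); simpl; lia.
Qed.

(** Left multiplication by [cf_step a] turns the rows (r, s) into (a r + s, r). Some of the bounds
    fail for the identity matrix, hence the separate nonempty clause. *)
Lemma cf_mat_order (l : list Z) :
  (forall a, In a l -> 0 < a) ->
  0 <= e22 (cf_mat l) /\ 0 <= e12 (cf_mat l) <= e11 (cf_mat l) /\
  0 <= e21 (cf_mat l) /\ 0 < e11 (cf_mat l) /\
  (l <> [] -> e21 (cf_mat l) <= e11 (cf_mat l) /\
              0 < e12 (cf_mat l) /\ 0 < e21 (cf_mat l) /\
              e22 (cf_mat l) <= e12 (cf_mat l) /\
              e22 (cf_mat l) <= e21 (cf_mat l)).
Proof.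
  induction l as [|a l IH]; intros Hl.
  - simpl. repeat split; try lia; congruence.
  - assert (Ha : 0 < a) by (apply Hl; now left).
    assert (Hl' : forall b, In b l -> 0 < b) by (intros b Hb; apply Hl; now right).
    specialize (IH Hl'). destruct IH as (H22 & H12 & H21 & H11 & Hne).
    simpl. destruct l as [|b l'].
    + simpl. repeat split; lia.
    + destruct Hne as (K1 & K2 & K3 & K4 & K5); [discriminate|].
      set (M := cf_mat (b :: l')) in *.
      repeat split; nia.
Qed.

Lemma cf_mat_ge_entry (l : list Z) (a : Z) :
  (forall a, In a l -> 0 < a) -> In a l -> a <= e11 (cf_mat l).
Proof.
  induction l as [|b l IH]; intros Hl Ha; [destruct Ha|].
  assert (Hb : 0 < b) by (apply Hl; now left).
  assert (Hl' : forall a, In a l -> 0 < a) by (intros x Hx; apply Hl; now right).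
  pose proof (cf_mat_order l Hl') as (H22 & H12 & H21 & H11 & _).
  simpl. destruct Ha as [->|Ha].
  - nia.
  - specialize (IH Hl' Ha). nia.
Qed.

(** Over a whole period [e12] is the Y of the candidate solution; this bounds it by the [e12] of any
    longer product that starts with that period. *)
Lemma cf_mat_prefix_mono (l l' : list Z) :
  l <> [] -> (forall a, In a (l ++ l') -> 0 < a) ->
  e12 (cf_mat l) <= e12 (cf_mat (l ++ l')).
Proof.
  intros Hl Hpos. destruct l' as [|b l'].
  { rewrite app_nil_r. lia. }
  rewrite cf_mat_app; simpl.
  destruct (cf_mat_order l) as (H22 & H12 & H21 & H11 & _).
  { intros a Ha. apply Hpos, in_or_app. now left. }
  destruct (cf_mat_order (b :: l')) as (_ & _ & _ & _ & K).
  { intros a Ha. apply Hpos, in_or_app. now right. }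
  destruct K as (_ & K2 & _ & _ & _); [discriminate|].
  destruct (cf_mat_order l') as (G22 & G12 & G21 & G11 & _).
  { intros a Ha. apply Hpos, in_or_app. right. now right. }
  simpl in K2. nia.
Qed.

(** * Complete quotients and the matrices relating them *)

Definition complete_quotients (b : nat -> Z) (xi : nat -> R) : Prop :=
  forall i, (1 < xi i)%R /\ xi i = (IZR (b i) + / xi (S i))%R.

(** The equation x = (e11 y + e12) / (e21 y + e22) with the denominator cleared. *)
Definition moebius_rel (M : mat2) (y x : R) : Prop :=
  (x * (IZR (e21 M) * y + IZR (e22 M)) = IZR (e11 M) * y + IZR (e12 M))%R.

Lemma complete_quotients_moebius (b : nat -> Z) (xi : nat -> R) (n k : nat) :
  complete_quotients b xi ->
  moebius_rel (cf_mat (map b (seq k n))) (xi (k + n)%nat) (xi k).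
Proof.
  intros H. revert k. induction n as [|n IH]; intros k.
  - unfold moebius_rel; simpl. rewrite Nat.add_0_r. lra.
  - specialize (IH (S k)). unfold moebius_rel in *.
    replace (k + S n)%nat with (S k + n)%nat by lia.
    set (y := xi (S k + n)%nat) in *.
    destruct (H k) as [_ Hk]. destruct (H (S k)) as [HS _].
    simpl. set (M := cf_mat (map b (seq (S k) n))) in *.
    rewrite !plus_IZR, !mult_IZR.
    set (z := xi (S k)) in *. rewrite Hk.
    transitivity (IZR (b k) * (IZR (e11 M) * y + IZR (e12 M)) +
                  / z * (IZR (e11 M) * y + IZR (e12 M)))%R; [ring|].
    rewrite <- IH at 2. field. lra.
Qed.

(** Both reciprocals lie strictly between 0 and 1, so [b] and [c] are the floor of the common
    value. *)
Lemma floor_decomposition_unique (b c : Z) (u v : R) :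
  (1 < u)%R -> (1 < v)%R -> (IZR b + / u = IZR c + / v)%R -> b = c /\ u = v.
Proof.
  intros Hu Hv E.
  assert (0 < / u < 1)%R.
  { split; [apply Rinv_0_lt_compat; lra|]. rewrite <- Rinv_1. apply Rinv_lt_contravar; lra. }
  assert (0 < / v < 1)%R.
  { split; [apply Rinv_0_lt_compat; lra|]. rewrite <- Rinv_1. apply Rinv_lt_contravar; lra. }
  assert (b = c).
  { assert (b < c + 1) by (apply lt_IZR; rewrite plus_IZR; lra).
    assert (c < b + 1) by (apply lt_IZR; rewrite plus_IZR; lra). lia. }
  subst c. split; [reflexivity|].
  rewrite <- (Rinv_inv u), <- (Rinv_inv v). f_equal. lra.
Qed.

(** Equal complete quotients have equal floors and equal successors, so one coincidence propagates
    to all later indices. *)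
Lemma complete_quotients_shift (b : nat -> Z) (xi : nat -> R) (n i : nat) :
  complete_quotients b xi -> xi n = xi 0%nat ->
  xi (i + n)%nat = xi i /\ b (i + n)%nat = b i.
Proof.
  intros H E.
  assert (K : forall i, xi (i + n)%nat = xi i).
  { clear i; intros i; induction i as [|i IH]; [exact E|].
    destruct (H i) as [_ Hi], (H (i + n)%nat) as [_ Hin].
    rewrite Hi, Hin in IH.
    apply floor_decomposition_unique in IH; [apply IH| apply H | apply H]. }
  split; [apply K|].
  pose proof (K i) as Hi.
  rewrite (proj2 (H i)), (proj2 (H (i + n)%nat)) in Hi.
  apply floor_decomposition_unique in Hi; [apply Hi | apply H | apply H].
Qed.

(* Euclid's algorithm on the rows of [M]: stripping [cf_step (b k)] off [M]
   replaces the rows (r, s) by (s, r - b k * s) and keeps all hypotheses. *)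
Lemma unimodular_is_cf_mat (b : nat -> Z) (xi : nat -> R) (M : mat2) (y : R) (k : nat) :
  complete_quotients b xi -> (1 < y)%R -> Z.abs (mat2_det M) = 1 ->
  0 <= e12 M <= e11 M -> 0 <= e22 M <= e21 M ->
  moebius_rel M y (xi k) ->
  exists n, M = cf_mat (map b (seq k n)) /\ y = xi (k + n)%nat.
Proof.
  intros Hxi Hy.
  (* The induction is on a bound for the sum of the bottom row, which each division step lowers. *)
  assert (Hmeas : exists N : nat, e21 M + e22 M <= Z.of_nat N).
  { exists (Z.to_nat (e21 M + e22 M)). lia. }
  destruct Hmeas as [N HN]. revert M k HN.
  induction N as [|N IH]; intros M k HN Hdet Hup Hlow Hrel.
  { unfold mat2_det in Hdet. nia. }
  destruct M as [a b' c d]; unfold mat2_det, moebius_rel in *; simpl in *.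
  destruct (Hxi k) as [_ Hk]. destruct (Hxi (S k)) as [HS _].
  set (q := b k) in *. set (z := xi (S k)) in *.
  set (a' := a - q * c). set (d' := b' - q * d).
  assert (Hc : 0 < c) by nia.
  assert (Hrel' : (z * (IZR a' * y + IZR d') = IZR c * y + IZR d)%R).
  { unfold a', d'. rewrite !minus_IZR, !mult_IZR.
    rewrite Hk in Hrel.
    replace (z * ((IZR a - IZR q * IZR c) * y + (IZR b' - IZR q * IZR d)))%R
      with (z * ((IZR a * y + IZR b') - IZR q * (IZR c * y + IZR d)))%R by ring.
    rewrite <- Hrel. field. lra. }
  assert (Hc1 : (1 <= IZR c)%R) by (apply IZR_le; lia).
  assert (Hd0 : (0 <= IZR d)%R) by (apply IZR_le; lia).
  set (s := (IZR a' * y + IZR d')%R) in *.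
  set (T := (IZR c * y + IZR d)%R) in *.
  assert (HT : (1 < T)%R) by (unfold T; nra).
  assert (Hs : (0 < s < T)%R) by nra.
  (* Subtracting a multiple of the bottom row keeps the determinant, so [e] is 1 or -1; with 0 < s <
     T, the identity a' T = c s + e then confines a' to [0, c]. *)
  set (e := a' * d - d' * c).
  assert (He : e = 1 \/ e = -1) by
    (assert (e = a * d - b' * c) by (unfold e, a', d'; ring); lia).
  assert (HeR : (-1 <= IZR e <= 1)%R) by (destruct He as [-> | ->]; simpl; lra).
  assert (Hid : (IZR a' * T = IZR c * s + IZR e)%R).
  { unfold T, s, e. rewrite minus_IZR, !mult_IZR. ring. }
  assert (Ee : e = a' * d - d' * c) by reflexivity.
  assert (Ea : a' = a - q * c) by reflexivity.
  assert (Ed : d' = b' - q * d) by reflexivity.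
  clearbody e a' d'.
  assert (Ha'0 : 0 <= a').
  { destruct (Z_lt_le_dec a' 0) as [Hlt|]; [|assumption]. exfalso.
    assert (IZR a' <= -1)%R by (apply IZR_le; lia). nra. }
  assert (Ha'c : a' <= c).
  { destruct (Z_lt_le_dec c a') as [Hlt|]; [|assumption]. exfalso.
    assert (IZR c + 1 <= IZR a')%R by (rewrite <- plus_IZR; apply IZR_le; lia). nra. }
  (* A zero remainder ends the algorithm: the determinant then forces the matrix to be
     [cf_step q]. *)
  destruct (Z.eq_dec a' 0) as [Hz|Hz].
    assert (Hd'pos : 0 < d').
    { apply lt_IZR. unfold s in Hs. rewrite Hz in Hs. lra. }
    assert (Hdc : d' * c = 1) by nia.
    assert (c = 1) by nia.
    assert (d' = 1) by nia.
    assert (d = 0) by (assert (d = 0 \/ d = 1) as [?|Hd1] by lia; [assumption|rewrite Hd1 in Ed; nia]).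
    exists 1%nat. split.
    + simpl. fold q. apply mat2_ext; simpl; nia.
    + rewrite Nat.add_1_r. fold z.
      unfold s, T in Hrel'. rewrite Hz in Hrel'.
      replace c with 1 in Hrel' by lia. replace d with 0 in Hrel' by lia.
      replace d' with 1 in Hrel' by lia. lra.
  - assert (Hd'0 : 0 <= d').
    { destruct (Z_lt_le_dec d' 0) as [Hlt|]; [|assumption]. exfalso.
      assert (c <= 1 - a' * d) by nia.
      assert (d = 0) by nia. nia. }
    assert (Hd'a' : d' <= a').
    { destruct (Z_lt_le_dec a' d') as [Hlt|]; [|assumption]. exfalso.
      assert (c = 1) by nia.
      assert (a' = 1) by lia. assert (d = 1) by nia.
      assert (IZR a' = 1 /\ IZR c = 1 /\ IZR d = 1)%R as (E1 & E2 & E3)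
        by (repeat split; f_equal; assumption).
      assert (2 <= IZR d')%R by (apply IZR_le; lia).
      unfold s, T in Hs. nra. }
    assert (Hdec : a' + d' < c + d).
    { destruct (Z.eq_dec a' c) as [E|E].
      - assert (d' < d); [|lia]. apply lt_IZR.
        unfold s, T in Hs. rewrite E in Hs. lra.
      - assert (d' <= d); [|lia]. nia. }
    destruct (IH (Mat2 c d a' d') (S k)) as (n & EM & Ey); simpl; try lia.
    + exact Hrel'.
    + exists (S n). split.
      * simpl. rewrite <- EM. fold q.
        apply mat2_ext; simpl; lia.
      * rewrite Ey. f_equal. lia.
Qed.

(** * Convergence of simple continued fractions and their tails *)

Lemma cf_convergent_bounds (b : nat -> Z) (n : nat) :
  (forall i, 0 < b i) ->
  (1 <= IZR (b 0%nat) <= cf_convergent b n)%R /\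
  (cf_convergent b n <= IZR (b 0%nat) + 1)%R.
Proof.
  revert b. induction n as [|n IH]; intros b Hb;
    assert (H0 : (1 <= IZR (b 0%nat))%R) by (apply IZR_le; specialize (Hb 0%nat); lia).
  - simpl. lra.
  - simpl. destruct (IH (fun i => b (S i))) as [H1 H2]; [intros i; apply Hb|].
    assert (0 < / cf_convergent (fun i => b (S i)) n <= 1)%R; [|lra].
    split; [apply Rinv_0_lt_compat; lra|].
    rewrite <- Rinv_1. apply Rinv_le_contravar; lra.
Qed.

(** Two levels are peeled off at a time: they contract by 1/((q u + 1)(q v + 1)) <= 1/4, whereas u,
    v >= 1 gives no factor below 1 for a single level. *)
Lemma cf_convergent_contraction (b : nat -> Z) (N n k : nat) :
  (forall i, 0 < b i) ->
  (Rabs (cf_convergent b (2 * N + n) - cf_convergent b (2 * N + k)) <= (/ 4) ^ N)%R.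
Proof.
  revert b. induction N as [|N IH]; intros b Hb.
  - simpl. destruct (cf_convergent_bounds b n Hb), (cf_convergent_bounds b k Hb).
    apply Rabs_le. lra.
  - replace (2 * S N + n)%nat with (S (S (2 * N + n))) by lia.
    replace (2 * S N + k)%nat with (S (S (2 * N + k))) by lia.
    specialize (IH (fun i => b (S (S i))) (fun i => Hb _)).
    assert (Hb2 : forall i, 0 < b (S (S i))) by (intros; apply Hb).
    cbn [cf_convergent].
    pose proof (cf_convergent_bounds _ (2 * N + n) Hb2) as [Hu _].
    pose proof (cf_convergent_bounds _ (2 * N + k) Hb2) as [Hv _].
    set (u := cf_convergent _ (2 * N + n)) in *.
    set (v := cf_convergent _ (2 * N + k)) in *.
    assert (H1 : (1 <= IZR (b 1%nat))%R) by (apply IZR_le; specialize (Hb 1%nat); lia).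
    set (q := IZR (b 1%nat)) in *.
    assert (Hqu : (2 <= q * u + 1)%R) by nra.
    assert (Hqv : (2 <= q * v + 1)%R) by nra.
    replace (IZR (b 0%nat) + / (q + / u) - (IZR (b 0%nat) + / (q + / v)))%R
      with ((u - v) * / ((q * u + 1) * (q * v + 1)))%R
      by (field; repeat split; try lra).
    rewrite Rabs_mult, (Rabs_right (/ _));
      [|apply Rle_ge, Rlt_le, Rinv_0_lt_compat; nra].
    simpl. rewrite Rmult_comm.
    apply Rmult_le_compat; [apply Rlt_le, Rinv_0_lt_compat; nra | apply Rabs_pos | | exact IH].
    apply Rinv_le_contravar; nra.
Qed.

Lemma cf_converges (b : nat -> Z) :
  (forall i, 0 < b i) -> exists x : R, is_simple_cf x b.
Proof.
  intros Hb.
  assert (Hc : ex_finite_lim_seq (cf_convergent b)).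
  { apply ex_lim_seq_cauchy_corr. intros eps.
    destruct (pow_lt_1_zero (/ 4)) with (y := pos eps) as [N HN].
    - rewrite Rabs_right; lra.
    - apply cond_pos.
    - exists (2 * N)%nat. intros n k Hn Hk.
      replace n with (2 * N + (n - 2 * N))%nat by lia.
      replace k with (2 * N + (k - 2 * N))%nat by lia.
      eapply Rle_lt_trans; [apply cf_convergent_contraction, Hb|].
      eapply Rle_lt_trans; [apply Rle_abs|]. apply HN. lia. }
  destruct Hc as [x Hx]. exists x. split; [intros; apply Hb | exact Hx].
Qed.

Lemma simple_cf_tail (x : R) (b : nat -> Z) :
  is_simple_cf x b ->
  (IZR (b 0%nat) < x)%R /\
  is_simple_cf (/ (x - IZR (b 0%nat))) (fun i => b (S i)).
Proof.
  intros [Hb Hx].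
  set (t := fun i => b (S i)).
  assert (Ht : forall i, 0 < t i) by (intros i; apply Hb; lia).
  assert (Hlim : is_lim_seq (fun n => / cf_convergent t n)%R (Finite (x - IZR (b 0%nat)))).
  { apply is_lim_seq_ext with (fun n => cf_convergent b (S n) - IZR (b 0%nat))%R.
    - intros n. cbn [cf_convergent]. fold t. ring.
    - apply is_lim_seq_minus'; [|apply is_lim_seq_const].
      apply (is_lim_seq_incr_1 (cf_convergent b)); exact Hx. }
  (* A lower bound uniform in n keeps the limit positive, so that it can be inverted. *)
  assert (Hpos : (/ (IZR (t 0%nat) + 1) <= x - IZR (b 0%nat))%R).
  { change (Rbar_le (Finite (/ (IZR (t 0%nat) + 1))) (Finite (x - IZR (b 0%nat)))).
    refine (is_lim_seq_le (fun _ => / (IZR (t 0%nat) + 1))%R _ _ _ _ (is_lim_seq_const _) Hlim).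
    intros n. destruct (cf_convergent_bounds t n Ht).
    apply Rinv_le_contravar; lra. }
  assert (Ht0 : (0 < IZR (t 0%nat))%R) by (apply IZR_lt, Ht).
  assert (Hgt : (0 < x - IZR (b 0%nat))%R).
  { eapply Rlt_le_trans; [|exact Hpos]. apply Rinv_0_lt_compat. lra. }
  split; [lra|]. split; [intros; apply Ht|].
  apply is_lim_seq_ext with (fun n => / / cf_convergent t n)%R.
  - intros n. apply Rinv_inv.
  - apply (is_lim_seq_inv _ (Finite (x - IZR (b 0%nat)))); [exact Hlim|].
    intros E. injection E. lra.
Qed.

Lemma cf_convergent_ext (b c : nat -> Z) (n : nat) :
  (forall i, b i = c i) -> cf_convergent b n = cf_convergent c n.
Proof.
  revert b c. induction n as [|n IH]; intros b c E; simpl.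
  - now rewrite E.
  - rewrite E. do 2 f_equal. apply IH. intros i. apply E.
Qed.

Lemma simple_cf_unique (x y : R) (b c : nat -> Z) :
  is_simple_cf x b -> is_simple_cf y c -> (forall i, b i = c i) -> x = y.
Proof.
  intros [_ Hx] [_ Hy] E.
  assert (H : Finite x = Finite y); [|now injection H].
  rewrite <- (is_lim_seq_unique _ _ Hx), <- (is_lim_seq_unique _ _ Hy).
  apply Lim_seq_ext. intros n. now apply cf_convergent_ext.
Qed.

(** The quotients iterate x -> 1 / (x - b n). Positivity of [b 0] is asked separately because
    [is_simple_cf] constrains only the later terms. *)
Lemma simple_cf_complete_quotients (x : R) (b : nat -> Z) :
  is_simple_cf x b -> (forall i, 0 < b i) ->
  exists xi, xi 0%nat = x /\ complete_quotients b xi /\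
    forall n, is_simple_cf (xi n) (fun i => b (i + n)%nat).
Proof.
  intros Hx Hb.
  set (xi := fix xi n := match n with
                         | O => x
                         | S n' => (/ (xi n' - IZR (b n')))%R
                         end).
  assert (Hxi : forall n, is_simple_cf (xi n) (fun i => b (i + n)%nat)).
  { induction n as [|n IH].
    - destruct Hx as [H1 H2]. split; [intros; apply Hb|].
      eapply is_lim_seq_ext; [|exact H2]. intros n. apply cf_convergent_ext.
      intros i. now rewrite Nat.add_0_r.
    - apply simple_cf_tail in IH. destruct IH as [_ [_ IH]].
      split; [intros; apply Hb|].
      eapply is_lim_seq_ext; [|exact IH]. intros k. apply cf_convergent_ext.
      intros i. f_equal. lia. }
  exists xi. split; [reflexivity|]. split; [|exact Hxi].
  intros n. destruct (simple_cf_tail _ _ (Hxi n)) as [Hlt _]. simpl in Hlt.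
  assert (1 <= IZR (b n))%R by (apply IZR_le; specialize (Hb n); lia).
  split; [lra|]. change (xi (S n)) with (/ (xi n - IZR (b n)))%R.
  rewrite Rinv_inv. ring.
Qed.

(** * Periodic and symmetric expansions *)

Lemma periodic_cf_complete_quotients (x : R) (b0 : Z) (block : list Z) :
  is_periodic_cf x b0 block ->
  exists xi,
    complete_quotients (fun i => nth (i mod length block)%nat block 0) xi /\
    x = (IZR b0 + / xi 0%nat)%R /\ xi (length block) = xi 0%nat.
Proof.
  intros [Hne Hx].
  assert (HL : length block <> 0%nat) by (destruct block; simpl; congruence).
  assert (Hb : forall i, 0 < nth (i mod length block)%nat block 0).
  { intros i. apply (proj1 Hx (S i)). lia. }
  apply simple_cf_tail in Hx. destruct Hx as [Hlt Hx]. simpl in Hlt, Hx.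
  destruct (simple_cf_complete_quotients _ _ Hx Hb) as (xi & H0 & Hcq & Hxi).
  exists xi. split; [exact Hcq|]. split.
  - rewrite H0, Rinv_inv. ring.
  - eapply simple_cf_unique; [apply Hxi | apply Hxi |].
    intros i. simpl. rewrite Nat.add_0_r.
    rewrite <- (Nat.mul_1_l (length block)) at 1. now rewrite Nat.Div0.mod_add.
Qed.

Lemma map_nth_seq {A : Type} (d : A) (l : list A) :
  map (fun i => nth (i mod length l)%nat l d) (seq 0 (length l)) = l.
Proof.
  apply nth_ext with (d := d) (d' := d); rewrite length_map, length_seq; [reflexivity|].
  intros n Hn.
  rewrite nth_indep with (d' := (fun i => nth (i mod length l)%nat l d) 0%nat)
    by (rewrite length_map, length_seq; lia).
  rewrite map_nth with (f := fun i => nth (i mod length l)%nat l d).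
  rewrite seq_nth by exact Hn. simpl. now rewrite Nat.mod_small.
Qed.

Lemma periodic_cf_block_pos (x : R) (b0 : Z) (block : list Z) :
  is_periodic_cf x b0 block -> forall a, In a block -> 0 < a.
Proof.
  intros [_ [Hb _]] a Ha.
  destruct (In_nth _ _ 0 Ha) as (n & Hn & <-).
  specialize (Hb (S n)). simpl in Hb. rewrite Nat.mod_small in Hb by exact Hn.
  apply Hb. lia.
Qed.

(** The first complete quotient z is fixed by the matrix of [w ++ [2 * b0]]. Symmetry of the matrix
    of [w] cancels a linear term in z, and after x = b0 + 1 / z the final 2 b0 leaves an equation in
    x^2 alone. *)
Lemma symmetric_cf_relation (x : R) (b0 : Z) (w : list Z) :
  rev w = w -> is_periodic_cf x b0 (w ++ [2 * b0]) ->
  (IZR (e11 (cf_mat w)) * (x ^ 2 - IZR b0 ^ 2) =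
   2 * IZR b0 * IZR (e12 (cf_mat w)) + IZR (e22 (cf_mat w)))%R.
Proof.
  intros Hw Hx.
  destruct (periodic_cf_complete_quotients _ _ _ Hx) as (xi & Hcq & E0 & Eper).
  pose proof (complete_quotients_moebius _ _ (length (w ++ [2 * b0])) 0 Hcq) as H.
  rewrite map_nth_seq in H. simpl (0 + _)%nat in H. rewrite Eper in H.
  rewrite cf_mat_app in H. unfold moebius_rel in H. simpl in H.
  rewrite (cf_mat_palindrome w Hw) in H.
  rewrite ?plus_IZR, ?mult_IZR, ?plus_IZR, ?mult_IZR in H.
  destruct (Hcq 0%nat) as [Hpos _]. set (z := xi 0%nat) in *.
  set (U := IZR (e11 (cf_mat w))) in *. set (V := IZR (e12 (cf_mat w))) in *.
  set (Z := IZR (e22 (cf_mat w))) in *. rewrite E0.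
  assert (Hz : (z <> 0)%R) by lra.
  apply Rmult_eq_reg_r with (z * z)%R; [|nra].
  transitivity (U * (2 * IZR b0 * z + 1))%R; [field; exact Hz|].
  lra.
Qed.

Lemma nth_mod_In {A : Type} (d : A) (l : list A) (i : nat) :
  l <> [] -> In (nth (i mod length l)%nat l d) l.
Proof.
  intros Hl. apply nth_In, Nat.mod_upper_bound. destruct l; [congruence | discriminate].
Qed.

(** Positivity makes the expansion converge to some x > 0, and [symmetric_cf_relation] then forces
    x^2 = D; no convergent is compared with sqrt D directly. *)
Lemma symmetric_cf_of_relation (D b0 : Z) (w : list Z) :
  rev w = w -> (forall a, In a w -> 0 < a) -> 0 < b0 ->
  e11 (cf_mat w) * (D - b0 ^ 2) = 2 * b0 * e12 (cf_mat w) + e22 (cf_mat w) ->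
  is_periodic_cf (sqrt (IZR D)) b0 (w ++ [2 * b0]).
Proof.
  intros Hw Hpos Hb0 Hrel.
  assert (Hne : w ++ [2 * b0] <> []) by (destruct w; discriminate).
  assert (Hb : forall i, 0 < periodic_seq b0 (w ++ [2 * b0]) i).
  { intros [|i]; [exact Hb0|]. cbn [periodic_seq].
    pose proof (nth_mod_In 0 _ i Hne) as Hin.
    apply in_app_or in Hin. destruct Hin as [Hin|[Hin|[]]]; [now apply Hpos | lia]. }
  destruct (cf_converges _ Hb) as [x Hx].
  assert (Hper : is_periodic_cf x b0 (w ++ [2 * b0])) by (split; assumption).
  pose proof (symmetric_cf_relation _ _ _ Hw Hper) as Hrel'.
  destruct (simple_cf_tail _ _ Hx) as [Hlt _]. simpl in Hlt.
  assert (Hb0R : (0 < IZR b0)%R) by now apply IZR_lt.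
  destruct (cf_mat_order w Hpos) as (_ & _ & _ & HU & _).
  apply IZR_lt in HU.
  apply (f_equal IZR) in Hrel.
  rewrite plus_IZR, !mult_IZR, minus_IZR in Hrel.
  change (b0 ^ 2) with (b0 ^ Z.of_nat 2) in Hrel. rewrite <- pow_IZR in Hrel.
  assert (HD : IZR D = (x ^ 2)%R).
  { apply Rmult_eq_reg_l with (IZR (e11 (cf_mat w))); lra. }
  rewrite HD, sqrt_pow2 by lra. exact Hper.
Qed.

(** * The fundamental solution read off a shortest period *)

Lemma is_fundamental_solution_unique (D X Y X' Y' : Z) :
  is_fundamental_solution D X Y -> is_fundamental_solution D X' Y' ->
  X = X' /\ Y = Y'.
Proof.
  intros [S H] [S' H']. specialize (H _ _ S'). specialize (H' _ _ S). lia.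
Qed.

(* A solution (X, Y) gives a unimodular matrix fixing the first complete
   quotient; being a product of [n] matrices [cf_step], it makes [n] a period. *)
Lemma fundamental_solution_of_symmetric_cf (D b0 : Z) (w : list Z) :
  rev w = w -> Nat.even (length w) = false ->
  is_periodic_cf (sqrt (IZR D)) b0 (w ++ [2 * b0]) ->
  is_least_period (periodic_seq b0 (w ++ [2 * b0])) (S (length w)) ->
  is_fundamental_solution D (b0 * e11 (cf_mat w) + e12 (cf_mat w)) (e11 (cf_mat w)).
Proof.
  intros Hw Hodd Hcf [_ Hleast].
  pose proof (periodic_cf_block_pos _ _ _ Hcf) as Hpos.
  assert (Hb0 : 0 < b0).
  { specialize (Hpos (2 * b0)). rewrite in_app_iff in Hpos. simpl in Hpos.
    specialize (Hpos (or_intror (or_introl eq_refl))). lia. }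
  assert (Hposw : forall a, In a w -> 0 < a) by (intros; apply Hpos, in_or_app; now left).
  destruct (periodic_cf_complete_quotients _ _ _ Hcf) as (xi & Hcq & E0 & _).
  set (r := (sqrt (IZR D) - IZR b0)%R).
  destruct (Hcq 0%nat) as [Hxi0 _].
  assert (Hr : (/ xi 0%nat = r)%R) by (unfold r; rewrite E0; ring).
  assert (Hr01 : (0 < r < 1)%R).
  { rewrite <- Hr. split; [apply Rinv_0_lt_compat; lra|].
    rewrite <- Rinv_1. apply Rinv_lt_contravar; lra. }
  assert (Hb0R : (1 <= IZR b0)%R) by (apply IZR_le; lia).
  assert (HD0 : (0 < IZR D)%R).
  { destruct (Rle_or_lt (IZR D) 0) as [Hle|]; [|assumption]. exfalso.
    apply sqrt_neg_0 in Hle. unfold r in Hr01. lra. }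
  assert (HDr : (IZR D = (IZR b0 + r) ^ 2)%R).
  { unfold r. replace (IZR b0 + (sqrt (IZR D) - IZR b0))%R with (sqrt (IZR D)) by ring.
    rewrite <- Rsqr_pow2. symmetry. apply Rsqr_sqrt. lra. }
  assert (Hlo : b0 * b0 < D) by (apply lt_IZR; rewrite mult_IZR; nra).
  assert (Hhi : D < (b0 + 1) * (b0 + 1))
    by (apply lt_IZR; rewrite mult_IZR, plus_IZR; nra).
  pose proof (symmetric_cf_relation _ _ _ Hw Hcf) as Hrel.
  replace (sqrt (IZR D) ^ 2)%R with (IZR D) in Hrel
    by (rewrite <- Rsqr_pow2; symmetry; apply Rsqr_sqrt; lra).
  rewrite (pow_IZR b0 2), <- minus_IZR, <- !mult_IZR, <- plus_IZR in Hrel.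
  apply eq_IZR in Hrel. change (Z.of_nat 2) with 2 in Hrel.
  pose proof (cf_mat_det w) as Hdet. rewrite Hodd in Hdet.
  unfold mat2_det in Hdet. rewrite (cf_mat_palindrome w Hw) in Hdet.
  destruct (cf_mat_order w Hposw) as (H22 & H12 & H21 & H11 & _).
  pose proof (cf_mat_prefix_mono (w ++ [2 * b0])) as Hmono.
  assert (EU : e12 (cf_mat (w ++ [2 * b0])) = e11 (cf_mat w)).
  { rewrite cf_mat_app. simpl. ring. }
  rewrite EU in Hmono. clear EU.
  set (U := e11 (cf_mat w)) in *. set (V := e12 (cf_mat w)) in *.
  set (Z0 := e22 (cf_mat w)) in *.
  (* By [Hrel] the norm is V^2 - U Z0, the negative of the determinant -1 of a product of odd
     length. *)
  assert (Hsol : (b0 * U + V) ^ 2 - D * U ^ 2 = 1).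
  { transitivity (- U * (U * (D - b0 ^ 2) - 2 * b0 * V) + V * V); [ring|].
    rewrite Hrel. lia. }
  split; [repeat split; [nia | exact H11 | exact Hsol]|].
  intros x y (Hx & Hy & Hxy).
  (* Since b0 is the floor of sqrt D, these bounds hold; they give the row inequalities required of
     the matrix below. *)
  assert (Hlow : b0 * y <= x) by nia.
  assert (Hup : x <= (b0 + 1) * y) by nia.
  assert (HyU : U <= y).
  (* The Moebius map of (x, D y; y, x) fixes sqrt D; conjugating by sqrt D = b0 + 1 / z gives this
     matrix, which fixes the first complete quotient z. *)
  { destruct (unimodular_is_cf_mat _ _
                (Mat2 (x + b0 * y) y ((D - b0 * b0) * y) (x - b0 * y))
                (xi 0%nat) 0 Hcq Hxi0) as (n & EM & En).
    - unfold mat2_det; simpl.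
      replace ((x + b0 * y) * (x - b0 * y) - y * ((D - b0 * b0) * y)) with 1; [reflexivity|].
      rewrite <- Hxy. ring.
    - simpl. nia.
    - simpl. nia.
    - unfold moebius_rel; simpl.
      rewrite <- (Rinv_inv (xi 0%nat)), Hr.
      rewrite ?plus_IZR, ?minus_IZR, ?mult_IZR, ?minus_IZR, ?mult_IZR, HDr.
      field. lra.
    - simpl in En.
      assert (Hn : (0 < n)%nat).
      { destruct n; [|lia]. apply (f_equal e12) in EM. simpl in EM. lia. }
      assert (Hper : is_period (periodic_seq b0 (w ++ [2 * b0])) n).
      { split; [exact Hn|]. intros [|i] Hi; [lia|].
        apply (complete_quotients_shift _ _ n i Hcq). now symmetry. }
      apply Hleast in Hper.
      assert (HL : length (w ++ [2 * b0]) = S (length w)) by (rewrite length_app; simpl; lia).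
      set (block := w ++ [2 * b0]) in *.
      (* As n is at least the length of the block, the product starts with one whole block. *)
      replace n with (length block + (n - length block))%nat in EM by lia.
      rewrite seq_app, map_app in EM.
      rewrite map_nth_seq in EM.
      apply (f_equal e12) in EM. simpl (e12 (Mat2 _ _ _ _)) in EM. rewrite EM.
      apply Hmono.
      + unfold block. destruct w; discriminate.
      + intros a Ha. apply in_app_or in Ha. destruct Ha as [Ha|Ha]; [now apply Hpos|].
        apply in_map_iff in Ha. destruct Ha as (i & <- & _).
        apply Hpos, nth_mod_In. unfold block. destruct w; discriminate. }
  split; [|exact HyU]. assert (U ^ 2 <= y ^ 2) by nia. assert (D * U ^ 2 <= D * y ^ 2) by nia. nia.
Qed.

(** A shorter period would carry the [z] ending the first block onto a term of [w] in the second. *)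
Lemma least_period_of_strict_max (b0 z : Z) (w : list Z) :
  (forall a, In a w -> a < z) ->
  is_least_period (periodic_seq b0 (w ++ [z])) (S (length w)).
Proof.
  intros Hmax.
  assert (HL : length (w ++ [z]) = S (length w)) by (rewrite length_app; simpl; lia).
  split.
  - split; [lia|]. intros [|i] Hi; [lia|]. simpl. rewrite HL.
    rewrite <- (Nat.mul_1_l (S (length w))) at 1. now rewrite Nat.Div0.mod_add.
  - intros q [Hq Hper]. destruct (le_lt_dec (S (length w)) q) as [|Hlt]; [assumption|].
    exfalso. specialize (Hper (S (length w))). specialize (Hper ltac:(lia)).
    simpl in Hper. rewrite HL in Hper.
    rewrite (Nat.mod_small (length w)) in Hper by lia.
    replace (length w + q)%nat with (q - 1 + 1 * S (length w))%nat in Hper by lia.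
    rewrite Nat.Div0.mod_add, Nat.mod_small in Hper by lia.
    rewrite (app_nth1 w) in Hper by lia.
    rewrite app_nth2, Nat.sub_diag in Hper by lia. simpl in Hper.
    assert (Hin : In (nth (q - 1) w 0) w) by (apply nth_In; lia).
    apply Hmax in Hin. lia.
Qed.

(** * The symmetric block and its norm equation *)

Lemma cf_mat_around (l : list Z) (mid : Z) :
  let M := cf_mat l in
  let v := mid * e11 M + 2 * e12 M in
  cf_mat (l ++ mid :: rev l) =
  Mat2 (e11 M * v) (e21 M * v + mat2_det M)
       (e21 M * v + mat2_det M) (e21 M * (mid * e21 M + 2 * e22 M)).
Proof.
  intros M v. rewrite cf_mat_app. simpl. rewrite cf_mat_rev.
  unfold v, mat2_det. apply mat2_ext; simpl; fold M; ring.
Qed.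

(** The left side is the relation of [symmetric_cf_relation] with the entries given by
    [cf_mat_around] for determinant -1; multiplied by A, it becomes the norm equation. *)
Lemma symmetric_relation_iff_norm (F b0 mid A B C D : Z) :
  0 < A -> A * D - B * C = -1 ->
  let v := mid * A + 2 * B in
  let p := b0 * A + C in
  A * v * (F - b0 ^ 2) = 2 * b0 * (C * v - 1) + C * (mid * C + 2 * D) <->
  v * (p ^ 2 - F * A ^ 2) = 2 * p.
Proof.
  intros HA Hdet v p.
  assert (E : A * (A * v * (F - b0 ^ 2) - 2 * b0 * (C * v - 1) - C * (mid * C + 2 * D)) =
              2 * p - v * (p ^ 2 - F * A ^ 2)).
  { transitivity (2 * p - v * (p ^ 2 - F * A ^ 2) - 2 * C * (A * D - B * C + 1));
      [unfold v, p; ring | rewrite Hdet; ring]. }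
  split; intros H.
  - replace (A * v * (F - b0 ^ 2) - _ - _) with 0 in E by lia. lia.
  - nia.
Qed.

(** Excludes f = 12 when the norm is 3; the analogue modulo 5 excludes f = 15. *)
Lemma square_neq_3_mod_4 (x k : Z) : x ^ 2 <> 4 * k + 3.
Proof.
  pose proof (Z.div_mod x 4 ltac:(lia)) as E. pose proof (Z.mod_pos_bound x 4 ltac:(lia)).
  assert (Hr : x mod 4 = 0 \/ x mod 4 = 1 \/ x mod 4 = 2 \/ x mod 4 = 3) by lia.
  rewrite E. destruct Hr as [-> | [-> | [-> | ->]]]; lia.
Qed.

Lemma square_neq_3_mod_5 (x k : Z) : x ^ 2 <> 5 * k + 3.
Proof.
  pose proof (Z.div_mod x 5 ltac:(lia)) as E. pose proof (Z.mod_pos_bound x 5 ltac:(lia)).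
  assert (Hr : x mod 5 = 0 \/ x mod 5 = 1 \/ x mod 5 = 2 \/ x mod 5 = 3 \/ x mod 5 = 4) by lia.
  rewrite E. destruct Hr as [-> | [-> | [-> | [-> | ->]]]]; lia.
Qed.

(* With [Q] the norm of [p + A sqrt f] and [P = f A B - p p'], the middle complete
   quotient is [(P + sqrt f) / Q]; its symmetry [2 P = am Q] together with
   [P < sqrt f < a0 + 1] leaves [Q = 2] and finitely many exceptions. *)
Lemma middle_norm_eq_2 (f a0 am A B C D : Z) :
  0 < B -> 0 < C -> 0 <= D -> B <= A -> C <= A -> A * D - B * C = -1 ->
  0 < am -> am = a0 \/ am = a0 - 1 ->
  (am * A + 2 * B) * ((a0 * A + C) ^ 2 - f * A ^ 2) = 2 * (a0 * A + C) ->
  (a0 * A + C) ^ 2 - f * A ^ 2 = 2.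
Proof.
  intros HB HC HD HBA HCA Hdet Ham Hcase Hrel.
  set (p := a0 * A + C) in *. set (v := am * A + 2 * B) in *.
  (* The matrix of a0 followed by the half block has rows (p, p') and (A, B), hence p B - p' A =
     1. *)
  set (p' := a0 * B + D).
  assert (Hcross : p' * A = p * B - 1).
  { unfold p, p'. transitivity (a0 * A * B + B * C + (A * D - B * C)); [ring|]. rewrite Hdet. ring. }
  assert (Ha0 : 0 < a0) by lia.
  assert (Hv : 0 < v) by (unfold v; nia).
  assert (Hp : 0 < p) by (unfold p; nia).
  set (Q := p ^ 2 - f * A ^ 2) in *.
  assert (HQ : 0 < Q) by nia.
  assert (HfA : f * A ^ 2 = p ^ 2 - Q) by (unfold Q; ring).
  set (P := f * A * B - p * p'). set (R := f * B ^ 2 - p' ^ 2).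
  assert (HP : 2 * P = am * Q).
  { apply Z.mul_reg_l with A; [lia|].
    transitivity (2 * (f * A ^ 2 * B - p * (p' * A))); [unfold P; ring|].
    rewrite HfA, Hcross. transitivity (2 * p - 2 * B * Q); [ring|].
    rewrite <- Hrel. unfold v. ring. }
  (* Brahmagupta's identity for the norms of p + A sqrt f and p' + B sqrt f. *)
  assert (HPR : f - P ^ 2 = Q * R).
  { transitivity (f * (p * B - p' * A) ^ 2 - P ^ 2).
    - replace (p * B - p' * A) with 1 by lia. ring.
    - unfold P, Q, R. ring. }
  assert (HR : 0 < R).
  { assert (E : A ^ 2 * R = Q * B * (v - B) - 1).
    { transitivity (f * A ^ 2 * B ^ 2 - (p' * A) ^ 2); [unfold R; ring|].
      rewrite HfA, Hcross. transitivity (2 * p * B - Q * B ^ 2 - 1); [ring|].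
      rewrite <- Hrel. ring. }
    assert (HvB : 2 <= v - B) by (clear - HB HBA Ham; unfold v; nia).
    clear - HB HBA HQ E HvB. clearbody v Q R.
    assert (1 <= Q * B) by nia.
    assert (0 < A ^ 2 * R) by nia. nia. }
  assert (Hf : f < (a0 + 1) ^ 2).
  { assert (H : f * A ^ 2 < (a0 + 1) ^ 2 * A ^ 2); [|clear - H; nia].
    rewrite HfA. assert (p <= (a0 + 1) * A) by (unfold p; lia).
    clear - HfA HQ Hp H. clearbody p Q. nia. }
  assert (HPa : P <= a0).
  { assert (0 < Q * R) by now apply Z.mul_pos_pos. clear - HPR Hf H Ha0. clearbody P Q R. nia. }
  assert (HP0 : 0 < P) by (clear - HP Ham HQ; clearbody P Q; nia).
  (* For Q = 1 the relation reads v = 2 p, and B <= A leaves only a0 = am = 1, where 2 P = am fails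
     by parity. *)
  assert (HQ1 : Q <> 1).
  { intros E. rewrite E in *.
    assert (2 * B = (2 * a0 - am) * A + 2 * C) by (unfold v, p in Hrel; lia).
    assert (2 * a0 - am <= 1) by (clear - H HB HC HBA; nia).
    lia. }
  destruct (Z_le_gt_dec Q 2) as [|HQ3]; [lia|]. exfalso.
  destruct Hcase as [E|E].
  (* Here 2 P = a0 Q >= 3 a0 contradicts P <= a0. *)
  - clear - HP HPa HQ3 E Ha0. clearbody P Q. nia.
  (* Here (a0 - 1) Q = 2 P <= 2 a0 with Q >= 3 gives a0 <= 3. *)
  - assert (a0 = 2 \/ a0 = 3) as [-> | ->] by (clear - HP HPa HQ3 E Ham; clearbody P Q; nia).
    + assert (HQP : Q = 4 /\ P = 2) by lia. destruct HQP as [HQ4 HP2].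
      rewrite HQ4, HP2 in *.
      assert (f = 8) by lia. subst f.
      (* From p^2 - 8 A^2 = 4 both p and A are even, hence C too, against A D - B C = -1. *)
      assert (HA : exists k, A = 2 * k).
      { clear - HfA. clearbody p.
        destruct (Z.Even_or_Odd p) as [[k ->] | [k ->]]; [|lia].
        destruct (Z.Even_or_Odd k) as [[j ->] | [j ->]]; [lia|].
        destruct (Z.Even_or_Odd A) as [HA | [i ->]]; [exact HA | lia]. }
      assert (HC2 : exists k, C = 2 * k).
      { clear - HfA. unfold p in HfA.
        destruct (Z.Even_or_Odd C) as [HC | [i ->]]; [exact HC | lia]. }
      destruct HA as [k ->], HC2 as [j ->]. clear - Hdet. lia.
    + assert (HQP : Q = 3 /\ P = 3) by lia. destruct HQP as [HQ4 HP2].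
      rewrite HQ4, HP2 in *.
      assert (f = 12 \/ f = 15) as [-> | ->] by lia.
      * now apply (square_neq_3_mod_4 p (3 * A ^ 2)); lia.
      * now apply (square_neq_3_mod_5 p (3 * A ^ 2)); lia.
Qed.

(** * Expansion and fundamental solution for f(t) *)

Lemma sym_block_eq (a : nat -> Z) (m : nat) (mid last : Z) :
  sym_block a m mid last =
  (map a (seq 1 (m - 1)) ++ mid :: rev (map a (seq 1 (m - 1)))) ++ [last].
Proof. unfold sym_block. now rewrite <- app_assoc. Qed.

Lemma rev_around {A : Type} (l : list A) (x : A) :
  rev (l ++ x :: rev l) = l ++ x :: rev l.
Proof.
  rewrite rev_app_distr. simpl. rewrite rev_involutive. now rewrite <- app_assoc.
Qed.

Lemma In_around {A : Type} (l : list A) (x y : A) :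
  In y (l ++ x :: rev l) <-> In y l \/ y = x.
Proof.
  rewrite in_app_iff. simpl. rewrite <- in_rev. intuition congruence.
Qed.

Theorem theorem3 (f c h : Z) (m : nat) (a : nat -> Z)
  (f_pos : 0 < f)
  (f_nonsquare : ~ exists k : Z, f = k ^ 2)
  (ch_fund : is_fundamental_solution f c h)
  (m_pos : (1 <= m)%nat)
  (sqrt_f : is_periodic_cf (sqrt (IZR f))
              (a 0%nat) (sym_block a m (a m) (2 * a 0%nat)))
  (period_f : is_least_period
                (periodic_seq (a 0%nat) (sym_block a m (a m) (2 * a 0%nat)))
                (2 * m))
  (a_m : a m = a 0%nat \/ a m = a 0%nat - 1)
  (m_even : Nat.Even m) :
  forall t : Z, 0 <= t ->
    let ft := (c + 1) ^ 2 * h ^ 2 * t ^ 2 + 2 * (c + 1) ^ 2 * t + f in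
    is_periodic_cf (sqrt (IZR ft))
      ((c + 1) * h * t + a 0%nat)
      (sym_block a m ((c + 1) * h * t + a m)
                     (2 * (c + 1) * h * t + 2 * a 0%nat)) /\
    is_fundamental_solution ft
      ((c + 1) * h ^ 4 * t ^ 2 + 2 * (c + 1) * h ^ 2 * t + c)
      (h ^ 3 * t + h).
Proof.
  intros t Ht ft. rewrite sym_block_eq in *.
  set (l := map a (seq 1 (m - 1))) in *.
  set (a0 := a 0%nat) in *. set (am := a m) in *.
  assert (Hlen : length l = (m - 1)%nat) by (unfold l; now rewrite length_map, length_seq).
  assert (Hw : forall x : Z, length (l ++ x :: rev l) = (2 * m - 1)%nat).
  { intros x. rewrite length_app. simpl. rewrite length_rev. lia. }
  assert (HwS : forall x : Z, S (length (l ++ x :: rev l)) = (2 * m)%nat)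
    by (intros x; rewrite Hw; lia).
  assert (Hodd : forall x : Z, Nat.even (length (l ++ x :: rev l)) = false).
  { intros x. rewrite Hw. replace (2 * m - 1)%nat with (S (2 * (m - 1))) by lia.
    rewrite Nat.even_succ, <- Nat.negb_even, Nat.even_mul. reflexivity. }
  (* As m is even, the half block has odd length m - 1; in particular it is nonempty. *)
  assert (Hdet : mat2_det (cf_mat l) = -1).
  { rewrite cf_mat_det, Hlen. destruct m_even as [n ->].
    replace (2 * n - 1)%nat with (S (2 * (n - 1))) by lia.
    rewrite Nat.even_succ, <- Nat.negb_even, Nat.even_mul. reflexivity. }
  pose proof (periodic_cf_block_pos _ _ _ sqrt_f) as Hblock.
  assert (Hpos : forall x, In x l \/ x = am -> 0 < x).
  { intros x Hx. apply Hblock, in_or_app. left. now apply In_around. }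
  assert (Ha0 : 0 < a0).
  { assert (0 < 2 * a0); [|lia]. apply Hblock, in_or_app. right. now left. }
  assert (Ham : 0 < am) by (apply Hpos; now right).
  assert (Hl : forall x, In x l -> 0 < x) by (intros; apply Hpos; now left).
  assert (Hlne : l <> []).
  { destruct m_even as [n ->]. intros E. rewrite E in Hlen. simpl in Hlen. lia. }
  pose proof (cf_mat_around l) as Haround. cbv zeta in Haround. rewrite Hdet in Haround.
  rewrite <- HwS with (x := am) in period_f.
  pose proof (fundamental_solution_of_symmetric_cf _ _ _ (rev_around l am) (Hodd am)
                sqrt_f period_f) as Hfund.
  destruct (is_fundamental_solution_unique _ _ _ _ _ ch_fund Hfund) as [Hc Hh].
  assert (Hrel : e11 (cf_mat (l ++ am :: rev l)) * (f - a0 ^ 2) =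
                 2 * a0 * e12 (cf_mat (l ++ am :: rev l)) + e22 (cf_mat (l ++ am :: rev l))).
  { pose proof (symmetric_cf_relation _ _ _ (rev_around l am) sqrt_f) as H.
    rewrite pow2_sqrt in H by (apply IZR_le; lia).
    apply eq_IZR. rewrite plus_IZR, !mult_IZR, minus_IZR.
    change (a0 ^ 2) with (a0 ^ Z.of_nat 2). rewrite <- pow_IZR. exact H. }
  rewrite Haround in Hc, Hh, Hrel. cbn [e11 e12 e21 e22] in Hc, Hh, Hrel.
  destruct (cf_mat_order l Hl) as (HD & _ & _ & HA & Hne).
  destruct (Hne Hlne) as (HCA & HB & HC & HDB & HDC).
  assert (HBA : e12 (cf_mat l) <= e11 (cf_mat l)) by (apply cf_mat_order, Hl).
  pose proof (fun x => cf_mat_ge_entry l x Hl) as Hentry.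
  unfold mat2_det in Hdet.
  destruct (cf_mat l) as [A B C D]; cbn [e11 e12 e21 e22] in *.
  apply symmetric_relation_iff_norm in Hrel; [|assumption..].
  pose proof (middle_norm_eq_2 _ _ _ _ _ _ _ HB HC HD HBA HCA Hdet Ham a_m Hrel) as Hnorm.
  rewrite Hnorm in Hrel.
  set (p := a0 * A + C) in *.
  assert (Hmid : am * A + 2 * B = p) by (clear - Hrel; lia).
  rewrite Hmid in *.
  assert (Hcp : c + 1 = p ^ 2) by (rewrite Hc; unfold p; ring).
  set (s := (c + 1) * h * t).
  assert (Hs : s = p ^ 3 * A * t) by (unfold s; rewrite Hcp, Hh; ring).
  assert (Hft : ft = s ^ 2 + 2 * p ^ 4 * t + f).
  { unfold ft, s. rewrite Hcp. ring. }
  assert (Hp : 0 < p) by (clear - Ha0 HA HC; unfold p; nia).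
  assert (Hs0 : 0 <= s).
  { rewrite Hs. apply Z.mul_nonneg_nonneg; [|assumption].
    apply Z.mul_nonneg_nonneg; [apply Z.pow_nonneg|]; now apply Z.lt_le_incl. }
  assert (Hcf : is_periodic_cf (sqrt (IZR ft)) (s + a0)
                  ((l ++ (s + am) :: rev l) ++ [2 * (s + a0)])).
  { apply symmetric_cf_of_relation; [apply rev_around | | now apply Z.add_nonneg_pos |].
    - intros x Hx. apply In_around in Hx. destruct Hx as [Hx| ->]; [now apply Hl | now apply Z.add_nonneg_pos].
    - rewrite Haround. cbn [e11 e12 e21 e22].
      apply symmetric_relation_iff_norm; [assumption..|].
      replace ((s + am) * A + 2 * B) with (p + A * s) by (rewrite <- Hmid; ring).
      replace ((s + a0) * A + C) with (p + A * s) by (unfold p; ring).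
      rewrite Hft.
      (* The cross term 2 p A s cancels 2 p^4 t A^2 because s = p^3 A t. *)
      replace ((p + A * s) ^ 2 - (s ^ 2 + 2 * p ^ 4 * t + f) * A ^ 2)
        with (p ^ 2 - f * A ^ 2); [rewrite Hnorm; ring|].
      rewrite Hs. ring. }
  assert (Hleast : is_least_period
            (periodic_seq (s + a0) ((l ++ (s + am) :: rev l) ++ [2 * (s + a0)]))
            (S (length (l ++ (s + am) :: rev l)))).
  (* At t = 0 the block is the given one. For t > 0 the entries of [l] are at most A <= s, and am <=
     a0, so 2 (s + a0) is a strict maximum. *)
  { destruct (Z.eq_dec t 0) as [E|E].
    - replace s with 0 by (rewrite Hs, E; ring). exact period_f.
    - apply least_period_of_strict_max. intros x Hx. apply In_around in Hx.
      destruct Hx as [Hx| ->]; [|clear - a_m Ha0 Hs0; lia].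
      apply Hentry in Hx.
      assert (HAs : A <= s); [|clear - Hx HAs Ha0 Hs0; lia].
      assert (Hpt : 0 < p ^ 3 * t) by (apply Z.mul_pos_pos; [now apply Z.pow_pos_nonneg | clear - Ht E; lia]).
      clear - Hs Hpt HA. clearbody s p. nia. }
  pose proof (fundamental_solution_of_symmetric_cf _ _ _ (rev_around l (s + am))
                (Hodd _) Hcf Hleast) as Hfund'.
  rewrite Haround in Hfund'. cbn [e11 e12 e21 e22] in Hfund'.
  replace (2 * (c + 1) * h * t + 2 * a0) with (2 * (s + a0)) by (unfold s; ring).
  split; [exact Hcf|].
  replace ((s + am) * A + 2 * B) with (p + A * s) in Hfund' by (rewrite <- Hmid; ring).
  replace (h ^ 3 * t + h) with (A * (p + A * s)) by (rewrite Hs, Hh; ring).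
  replace ((c + 1) * h ^ 4 * t ^ 2 + 2 * (c + 1) * h ^ 2 * t + c)
    with ((s + a0) * (A * (p + A * s)) + (C * (p + A * s) + -1)); [exact Hfund'|].
  (* The analogue of c = p^2 - 1, with p replaced by p + A s. *)
  transitivity ((p + A * s) ^ 2 - 1); [unfold p; ring|].
  replace c with (p ^ 2 - 1) by (rewrite <- Hcp; ring).
  rewrite Hs, Hh. ring.
Qed.
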